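(* Let $p\ge 2$. There is a constant $c>0$ depending only on $p,d$ such that for all $t\ge 1$, $$\varphi_{M_p}(t)\ge c\, t^{\frac{1}{p-1}}\big(\log(t+e)\big)^{-\frac1p},$$ where $\varphi_{M_p}(t):=\sup_{[w]_{A_p}\le t}\|M_{w,p}\|_{L^p\to L^{p,\infty}}$.
   Context: A scalar weight $w$ is a non-negative locally integrable function on $\mathbb{R}^d$, and for $p>1$ $$[w]_{A_p}:=\sup_{Q}\Big(\frac{1}{|Q|}\int_Qw\Big)\Big(\frac{1}{|Q|}\int_Qw^{-\frac{1}{p-1}}\Big)^{p-1},$$ the supremum being over all cubes $Q\subset\mathbb{R}^d$. For a scalar weight $w$ with $[w]_{A_p}<\infty$, $$M_{w,p}f(x):=\sup_{Q\ni x}\frac{1}{|Q|}\int_Q w(x)^{1/p}w(y)^{-1/p}|f(y)|\,dy,$$ the supremum being over all cubes $Q$ containing $x$. The weak norm (with respect to Lebesgue measure) is $\|g\|_{L^{p,\infty}}=\sup_{\alpha>0}\alpha\,|\{x:|g(x)|>\alpha\}|^{1/p}$, and $\|M_{w,p}\|_{L^p\to L^{p,\infty}}$ is the smallest constant $K$ with $\|M_{w,p}f\|_{L^{p,\infty}}\le K\|f\|_{L^p}$ for all $f\in L^p(\mathbb{R}^d)$. The supremum defining $\varphi_{M_p}(t)$ is over all scalar weights $w$ with $[w]_{A_p}\le t$. *)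

(* Defs.v *)
From HB Require Import structures.
From mathcomp Require Import all_boot all_order all_algebra.
From mathcomp Require Import all_classical all_reals all_analysis.
Import Order.TTheory GRing.Theory Num.Theory.
Import numFieldNormedType.Exports.

Set Implicit Arguments.
Unset Strict Implicit.
Unset Printing Implicit Defensive.

Local Open Scope classical_set_scope.
Local Open Scope ring_scope.

Definition measure_rV_display : measure_display -> measure_display.
Proof. exact. Qed.

(* ['rV[T]_n] carries the product sigma-algebra; for [T] the reals this is the
   Borel sigma-algebra of R^n. *)
Section measurable_rV.
Context {d} {T : measurableType d}.
Variable n : nat.

Let coors : 'I_n -> 'rV[T]_n -> T := fun i x => x ord0 i.

Let rV_set0 : g_sigma_preimage coors set0.
Proof. exact: sigma_algebra0. Qed.

Let rV_setC A : g_sigma_preimage coors A -> g_sigma_preimage coors (~` A).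
Proof. exact: sigma_algebraC. Qed.

Let rV_bigcup (F : _^nat) : (forall i, g_sigma_preimage coors (F i)) ->
  g_sigma_preimage coors (\bigcup_i (F i)).
Proof. exact: sigma_algebra_bigcup. Qed.

HB.instance Definition _ := @isMeasurable.Build (measure_rV_display d)
  'rV[T]_n (g_sigma_preimage coors) rV_set0 rV_setC rV_bigcup.

End measurable_rV.

Lemma measurable_coord d (T : measurableType d) n (i : 'I_n) :
  measurable_fun [set: 'rV[T]_n] (fun x => x ord0 i).
Proof.
move=> _ Y mY; rewrite setTI; apply: sub_sigma_algebra => /=.
rewrite -bigcup_seq/=; exists i => /=; first by rewrite mem_index_enum.
by exists Y => //; rewrite setTI.
Qed.

Lemma measurable_fun_coordP d1 d2 (T1 : measurableType d1)
    (T2 : measurableType d2) n (f : T1 -> 'rV[T2]_n) :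
  measurable_fun [set: T1] f <->
  forall i, measurable_fun [set: T1] (fun x => f x ord0 i).
Proof.
split=> [mf i|mf].
  apply: (@measurableT_comp _ _ _ _ _ _ (fun x : 'rV[T2]_n => x ord0 i)) => //.
  exact: measurable_coord.
move=> _ Y mY; rewrite setTI.
have : [set f @^-1` A | A in @measurable _ 'rV[T2]_n] `<=` measurable.
  rewrite (_ : [set _ | _ in _] = preimage_set_system setT f measurable); last first.
    by apply/seteqP; split=> _ [A mA <-]; exists A => //; rewrite setTI.
  rewrite -(@g_sigma_preimage_comp _ _ _ 'rV[T2]_n).
  apply: smallest_sub; first exact: sigma_algebra_measurable.
  rewrite -bigcup_seq => A [i /= _ [B mB <-]]; exact: mf.
by apply; exists Y.
Qed.

Section lebesgue_rV.
Context {R : realType}.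

Definition consrV n (p : R * 'rV[R]_n) : 'rV[R]_n.+1 :=
  \row_i oapp (fun j => p.2 ord0 j) p.1 (unlift ord0 i).

Definition unconsrV n (x : 'rV[R]_n.+1) : R * 'rV[R]_n :=
  (x ord0 ord0, \row_j x ord0 (lift ord0 j)).

Lemma consrVK n : cancel (@consrV n) (@unconsrV n).
Proof.
move=> [a x]; congr pair; first by rewrite mxE unlift_none.
by apply/rowP => j; rewrite !mxE liftK.
Qed.

Lemma measurable_consrV n : measurable_fun [set: R * 'rV[R]_n] (@consrV n).
Proof.
apply/measurable_fun_coordP => i.
under eq_fun do rewrite mxE.
case: unliftP => [j _|_] /=; last exact: measurable_fst.
apply: (@measurableT_comp _ _ _ _ _ _ (fun x : 'rV[R]_n => x ord0 j)) => //.
exact: measurable_coord.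
Qed.

Lemma measurable_unconsrV n : measurable_fun [set: 'rV[R]_n.+1] (@unconsrV n).
Proof.
apply: measurable_fun_pair; first exact: measurable_coord.
apply/measurable_fun_coordP => j; under eq_fun do rewrite mxE.
exact: measurable_coord.
Qed.

Section step.
Variable n : nat.
Variable m : {sigma_finite_measure set 'rV[R]_n -> \bar R}.

Definition lebesgue_rV_step : set 'rV[R]_n.+1 -> \bar R :=
  pushforward (@lebesgue_measure R \x m)%E (@consrV n).

Let step0 : lebesgue_rV_step set0 = 0%E.
Proof. by rewrite /lebesgue_rV_step /pushforward preimage_set0 measure0. Qed.

Let step_ge0 A : (0 <= lebesgue_rV_step A)%E.
Proof. by rewrite /lebesgue_rV_step /pushforward. Qed.

Let step_sigma_additive : semi_sigma_additive lebesgue_rV_step.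
Proof.
have mf := @measurable_consrV n.
exact: (@measure_semi_sigma_additive _ _ _
  (pushforward (@lebesgue_measure R \x m)%E (@consrV n))).
Qed.

HB.instance Definition _ := isMeasure.Build _ _ _ lebesgue_rV_step
  step0 step_ge0 step_sigma_additive.

Let step_sigma_finite : sigma_finite setT lebesgue_rV_step.
Proof.
have /sigma_finiteP[F [TF ndF Foo]] := sigma_finiteT (@lebesgue_measure R).
have /sigma_finiteP[G [TG ndG Goo]] := sigma_finiteT m.
have mFG k : measurable (F k `*` G k).
  by apply: measurableX; [have [] := Foo k|have [] := Goo k].
exists (fun k => @unconsrV n @^-1` (F k `*` G k)).
  rewrite -preimage_bigcup (_ : \bigcup_k _ = setT) ?preimage_setT//.
  rewrite -subTset => -[a x] _.
  have [k _ Fka] : (\bigcup_k F k) a by rewrite -TF.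
  have [l _ Glx] : (\bigcup_k G k) x by rewrite -TG.
  exists (maxn k l) => //; split=> /=.
  - by move: a Fka; exact/subsetPset/ndF/leq_maxl.
  - by move: x Glx; exact/subsetPset/ndG/leq_maxr.
move=> k; have [[mFk Fkoo] [mGk Gkoo]] := (Foo k, Goo k); split.
  by rewrite -(setTI (_ @^-1` _)); apply: measurable_unconsrV => //; exact: mFG.
rewrite /lebesgue_rV_step /pushforward -comp_preimage.
rewrite (_ : _ \o _ = id) ?preimage_id; last first.
  by apply/funext => p; exact: consrVK.
by rewrite product_measure1E// lte_mul_pinfty// ge0_fin_numE.
Qed.

HB.instance Definition _ := Measure_isSigmaFinite.Build _ _ _
  lebesgue_rV_step step_sigma_finite.

End step.

Let dirac0_sigma_finite :
  sigma_finite setT (dirac (0 : 'rV[R]_0) : {measure set 'rV[R]_0 -> \bar R}).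
Proof.
exists (fun=> setT); first by rewrite bigcup_const.
by move=> _; split; [exact: measurableT|rewrite /= diracE ltry].
Qed.

HB.instance Definition _ := Measure_isSigmaFinite.Build _ _ _
  (dirac (0 : 'rV[R]_0) : set 'rV[R]_0 -> \bar R) dirac0_sigma_finite.

(* Lebesgue measure on R^n, as the n-fold product of the one on R. *)
Fixpoint lebesgue_rV n : {sigma_finite_measure set 'rV[R]_n -> \bar R} :=
  if n is k.+1 then lebesgue_rV_step (lebesgue_rV k)
  else dirac (0 : 'rV[R]_0).

Lemma lebesgue_rV_box n (A : 'I_n -> set R) : (forall i, measurable (A i)) ->
  lebesgue_rV n [set x : 'rV[R]_n | forall i, A i (x ord0 i)] =
  (\prod_(i < n) lebesgue_measure (A i))%E.
Proof.
elim: n A => [|n IH] A mA.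
  rewrite big_ord0 /= diracE mem_set//; by case.
rewrite big_ord_recl.
transitivity ((lebesgue_measure \x lebesgue_rV n)%E
    (A ord0 `*` [set x : 'rV[R]_n | forall i : 'I_n, A (lift ord0 i) (x ord0 i)])).
  congr (lebesgue_measure \x lebesgue_rV n)%E.
  apply/seteqP; split=> [[a x] /= Ax|[a x] /= [Aa Ax] i].
    split=> [|i]; first by have := Ax ord0; rewrite mxE unlift_none.
    by have := Ax (lift ord0 i); rewrite mxE liftK.
  by rewrite mxE; case: unliftP => [j ->|->].
rewrite product_measure1E//; first by congr (_ * _)%E; apply: IH => i.
  exact: mA.
have -> : [set x : 'rV[R]_n | forall i : 'I_n, A (lift ord0 i) (x ord0 i)] =
    \bigcap_(i in [set: 'I_n])
      ((fun x : 'rV[R]_n => x ord0 i) @^-1` A (lift ord0 i)).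
  by apply/seteqP; split=> [x Ax i _|x Ax i]; [exact: Ax|exact: (Ax i)].
apply: fin_bigcap_measurable => // i _.
by rewrite -[X in measurable X]setTI; exact: measurable_coord.
Qed.

End lebesgue_rV.

Section weights.
Context {R : realType} {d : nat}.
Local Notation mu := (lebesgue_rV d : {measure set 'rV[R]_d -> \bar R}).
Implicit Types (w f : 'rV[R]_d -> R) (g : 'rV[R]_d -> \bar R) (p t : R).

Definition cubes : set (set 'rV[R]_d) :=
  [set Q | exists a : 'rV[R]_d, exists l : R, 0 < l /\
    Q = [set x : 'rV[R]_d | forall i, a ord0 i <= x ord0 i <= a ord0 i + l]].

Local Open Scope ereal_scope.

Definition locally_integrable_rV w := measurable_fun [set: 'rV[R]_d] w /\
  forall K, compact K -> \int[mu]_(x in K) `|w x|%:E < +oo.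

Definition scalar_weight w := (forall x, (0 <= w x)%R) /\ locally_integrable_rV w.

Definition cube_avg (Q : set 'rV[R]_d) g := (mu Q)^-1 * \int[mu]_(y in Q) g y.

(* [w x] to a negative power must be [+oo] where [w x = 0]; the library has
   [0 `^ (- s) = 0], so negative powers are written as extended-real inverses
   of positive powers, with [0^-1 = +oo]. *)
Definition Ap_const p w := ereal_sup
  [set cube_avg Q (EFin \o w) *
       cube_avg Q (fun y => ((w y)%:E `^ (p - 1)^-1)^-1) `^ (p - 1)
  | Q in cubes].

Definition maximal_weighted w p f (x : 'rV[R]_d) := ereal_sup
  [set cube_avg Q
    (fun y => (w x)%:E `^ p^-1 * ((w y)%:E `^ p^-1)^-1 * `|f y|%:E)
  | Q in cubes `&` [set Q | Q x]].

Definition weak_Lnorm p g := ereal_sup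
  [set a%:E * mu [set x | a%:E < `|g x|] `^ p^-1 | a in [set a | (0 < a)%R]].

Definition weak_opnorm p (T : ('rV[R]_d -> R) -> 'rV[R]_d -> \bar R) :=
  ereal_inf [set K%:E | K in [set K | (0 <= K)%R /\
    forall f, f \in Lfun mu p%:E ->
      weak_Lnorm p (T f) <= K%:E * 'N[mu]_p%:E[EFin \o f]]].

Definition phi_M p t := ereal_sup
  [set weak_opnorm p (maximal_weighted w p)
  | w in [set w | scalar_weight w /\ Ap_const p w <= t%:E]].

End weights.
Arguments phi_M {R} d p t.

(* Main.v *)
Require Import Defs.
From mathcomp Require Import all_boot all_order all_algebra.
From mathcomp Require Import all_classical all_reals all_analysis.
From mathcomp Require Import measurable_realfun ring lra.
Import Order.TTheory GRing.Theory Num.Theory.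
Import numFieldNormedType.Exports.

Set Implicit Arguments.
Unset Strict Implicit.
Unset Printing Implicit Defensive.

Local Open Scope classical_set_scope.
Local Open Scope ring_scope.

(** The weights are functions of the first coordinate, so the problem is one
    dimensional; let [q = p - 1 >= 1].  For an integer [N >= 1] the weight is
    [w = base `^ (- q) + (sum of N bumps)].

    The function [base] is comparable to [1] for [|x| <= 1], to
    [1 / (N * |x|)] for [1 <= |x| <= 4 ^ N], and constant further away.  It is
    an A_1 weight of constant of order [N], because its average over [[0, r]] is
    of order [1 / r] for [1 <= r <= 4 ^ N]: the logarithmically many scales
    below [r] contribute at most [1 + log r / N] times [1 / r].  Hence the A_p constant of [base `^ (- q)] is of order
    [N ^ q].  The [k]-th bump is the same profile translated to the centre
    [c_k = 4 ^ k.+1], cut off at distance [4 ^ k] of it, and multiplied by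
    [N ^ q * c_k ^ p].  It concentrates, on an interval of radius [1], as much
    mass as [base `^ (- q)] carries at the scale [c_k].

    Adding the bumps keeps the A_p constant of order [N ^ q]
    ([weight_Ap_const]).  The bumps only decrease the dual weight, so what
    remains to be bounded is their average over an interval [I] times the [q]-th
    power of the average of the dual weight.  The bumps whose support contains
    [I] form an A_1 weight on [I] of constant of order [N <= N ^ q].  For the
    other bumps that meet [I], the centre [c_k] is at most twice the largest
    [|x|] on [I], and [I] reaches at least the edge of the support.  They form a
    geometric series, and their total average is at most of the order of the value of
    [base `^ (- q)] at the end of [I] farther from the origin.

    The test function is the indicator of [0 <= x_0 <= 1], cut off in the other
    directions, on which [w <= 1].  Near [c_k] the averages are at least about
    [1 / c_k], while [w ^ (1 / p)] is at least [N ^ (q / p) * c_k].  Thus the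
    weighted maximal function exceeds [N ^ (q / p) / 2] on all the [N] intervals
    of radius [1] around the centres at once, and the weak-type norm is at least
    [N ^ (q / p) * N ^ (1 / p) / 2 = N / 2] ([weight_weak_opnorm]).  Choosing
    [N ^ q] of order [t] gives a bound from below of order [t ^ (1 / q)], and
    [ln (t + e) >= 1]. *)

(** * Monotonicity on arbitrary sets *)

(** The integral of a nonnegative function is a supremum over the simple
    functions below it, and hence monotone on arbitrary functions. *)
Lemma ge0_le_integral_nonmeasurable d (T : measurableType d) (R : realType)
    (mu : {measure set T -> \bar R}) (D : set T) (f g : T -> \bar R) :
  (forall x, D x -> (0 <= f x)%E) -> (forall x, D x -> (f x <= g x)%E) ->
  (\int[mu]_(x in D) f x <= \int[mu]_(x in D) g x)%E.
Proof.
move=> f0 fg.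
have g0 x : D x -> (0 <= g x)%E by move=> Dx; exact: le_trans (f0 x Dx) (fg x Dx).
rewrite !ge0_integralE//; apply: ereal_sup_le => _ [h hf <-].
exists h => // x; apply: le_trans (hf x) _; rewrite /patch.
by case: ifPn => // /set_mem; exact: fg.
Qed.

(** The superlevel sets of the maximal function enter the weak norm as they
    are.  Comparing them with a subset of known measure needs monotonicity
    beyond measurable sets: it holds because a one-dimensional section is
    measured by an outer measure and the sections are integrated by a supremum
    over simple functions. *)
Lemma le_lebesgue_rV (R : realType) n (A B : set 'rV[R]_n) :
  A `<=` B -> (lebesgue_rV n A <= lebesgue_rV n B)%E.
Proof.
elim: n A B => [|n IH] A B AB /=.
  rewrite !diracE lee_fin ler_nat.
  case: (boolP (0 \in A)) => [/set_mem/AB/mem_set ->//|_].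
  by case: (_ \in B).
rewrite /lebesgue_rV_step /pushforward /product_measure1 /=.
apply: ge0_le_integral_nonmeasurable => x _ //=.
by apply: IH => y; rewrite /xsection/= !inE; exact: AB.
Qed.

(** * Cubes, prisms and averages of functions of the first coordinate *)

(** All sets of the proof are products of a subset of the line with a cube of
    the other coordinates. *)
Definition prism (R : realType) n (A : set R) (b : 'I_n -> R) (l : R) :
    set 'rV[R]_n.+1 :=
  [set x | A (x ord0 ord0) /\
    forall i, b i <= x ord0 (lift ord0 i) <= b i + l].

Definition cube (R : realType) d (a : 'rV[R]_d) (l : R) : set 'rV[R]_d :=
  [set x | forall i, a ord0 i <= x ord0 i <= a ord0 i + l].

Lemma prismE (R : realType) n (A : set R) (b : 'I_n -> R) (l : R) :
  prism A b l = [set x : 'rV[R]_n.+1 | forall i,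
    (oapp (fun j => `[b j, b j + l]%classic) A (unlift ord0 i)) (x ord0 i)].
Proof.
apply/seteqP; split => [x [Ax bx] i|x Ax] /=.
  by case: unliftP => [j ->|->] //=; rewrite in_itv/=.
split; first by have := Ax ord0; rewrite unlift_none.
by move=> i; have := Ax (lift ord0 i); rewrite liftK/= ?in_itv.
Qed.

Lemma cubeE (R : realType) n (a : 'rV[R]_n.+1) (l : R) :
  cube a l = prism (n := n) `[a ord0 ord0, a ord0 ord0 + l]%classic
                   (fun i : 'I_n => a ord0 (lift ord0 i)) l.
Proof.
apply/seteqP; split => [x ax|x [ax bx] i] /=.
  by split; [rewrite /= in_itv/=|move=> i]; exact: ax.
by case: (unliftP ord0 i) => [j ->|->]; [exact: bx|move: ax; rewrite /= ?in_itv].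
Qed.

Lemma measurable_prism (R : realType) n (A : set R) (b : 'I_n -> R) (l : R) :
  measurable A -> measurable (prism A b l).
Proof.
move=> mA; rewrite prismE.
have -> : [set x : 'rV[R]_n.+1 | forall i,
    (oapp (fun j => `[b j, b j + l]%classic) A (unlift ord0 i)) (x ord0 i)] =
  \bigcap_(i in [set: 'I_n.+1]) ((fun x : 'rV[R]_n.+1 => x ord0 i) @^-1`
    (oapp (fun j => `[b j, b j + l]%classic) A (unlift ord0 i))).
  by apply/seteqP; split=> [x Ax i _|x Ax i]; [exact: Ax|exact: (Ax i)].
apply: fin_bigcap_measurable => // i _.
rewrite -[X in measurable X]setTI; apply: measurable_coord => //.
by case: unliftP => [j _|_] //=; exact: measurable_itv.
Qed.

Lemma lebesgue_measure_segment (R : realType) (a l : R) : 0 <= l ->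
  lebesgue_measure `[a, a + l]%classic = l%:E.
Proof.
move=> l0; rewrite lebesgue_measure_itv/= lte_fin -EFinD addrAC subrr add0r.
case: ltP => //; rewrite gerDl => l0'.
by congr EFin; apply: le_anti; rewrite l0 l0'.
Qed.

Lemma lebesgue_rV_prism (R : realType) n (A : set R) (b : 'I_n -> R) (l : R) :
  measurable A -> 0 <= l ->
  lebesgue_rV n.+1 (prism A b l) = (lebesgue_measure A * (l ^+ n)%:E)%E.
Proof.
move=> mA l0; rewrite prismE (lebesgue_rV_box (A := fun i =>
    oapp (fun j => `[b j, b j + l]%classic) A (unlift ord0 i))); last first.
  by move=> i; case: unliftP => [j _|_] //=; exact: measurable_itv.
rewrite big_ord_recl unlift_none /=; congr (_ * _)%E.
under eq_bigr do rewrite liftK /= lebesgue_measure_segment//.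
elim: n A {b mA} => [|n IH] A; first by rewrite big_ord0.
by rewrite big_ord_recl/= IH// -EFinM exprS.
Qed.

Lemma measurable_cube (R : realType) n (a : 'rV[R]_n.+1) (l : R) :
  measurable (cube a l).
Proof.
rewrite cubeE; apply: (@measurable_prism R n _ (fun i => a ord0 (lift ord0 i))).
exact: measurable_itv.
Qed.

Lemma lebesgue_rV_cube (R : realType) n (a : 'rV[R]_n.+1) (l : R) :
  0 <= l -> lebesgue_rV n.+1 (cube a l) = (l ^+ n.+1)%:E.
Proof.
move=> l0; rewrite cubeE lebesgue_rV_prism//.
by rewrite lebesgue_measure_segment// -EFinM exprS.
Qed.

Lemma cube_avg_cubeE (R : realType) n (a : 'rV[R]_n.+1) (l : R) g : 0 < l ->
  cube_avg (cube a l) g =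
  ((l ^+ n.+1)^-1%:E * \int[lebesgue_rV n.+1]_(y in cube a l) g y)%E.
Proof.
move=> l0; transitivity
  ((l ^+ n.+1)%:E^-1 * \int[lebesgue_rV n.+1]_(y in cube a l) g y)%E.
  by congr (_^-1 * _)%E; exact: lebesgue_rV_cube (ltW l0).
by rewrite inver expf_eq0 gt_eqF.
Qed.

Lemma le_cube_avg (R : realType) n (a : 'rV[R]_n.+1) (l : R)
    (g h : 'rV[R]_n.+1 -> \bar R) : 0 < l ->
  (forall y, cube a l y -> (0 <= g y)%E) ->
  (forall y, cube a l y -> (g y <= h y)%E) ->
  (cube_avg (cube a l) g <= cube_avg (cube a l) h)%E.
Proof.
move=> l0 g0 gh; rewrite !cube_avg_cubeE//; apply: lee_wpmul2l.
  by rewrite lee_fin invr_ge0 exprn_ge0// ltW.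
exact: ge0_le_integral_nonmeasurable.
Qed.

Lemma cube_avg_ge0 (R : realType) n (a : 'rV[R]_n.+1) (l : R)
    (g : 'rV[R]_n.+1 -> \bar R) : 0 < l ->
  (forall y, cube a l y -> (0 <= g y)%E) -> (0 <= cube_avg (cube a l) g)%E.
Proof.
move=> l0 g0; rewrite cube_avg_cubeE// mule_ge0 ?integral_ge0//.
by rewrite lee_fin invr_ge0 exprn_ge0// ltW.
Qed.

Lemma cube_avg_cst (R : realType) n (a : 'rV[R]_n.+1) (l c : R) : 0 < l ->
  cube_avg (cube a l) (fun=> c%:E) = c%:E.
Proof.
move=> l0; rewrite cube_avg_cubeE// integral_cst; last exact: measurable_cube.
rewrite /= lebesgue_rV_cube ?(ltW l0)// -!EFinM mulrCA mulVf ?mulr1//.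
by rewrite expf_eq0 gt_eqF.
Qed.

Lemma measurable_comp_coord0 (R : realType) n (D : set 'rV[R]_n.+1) (g : R -> R) :
  measurable_fun setT g ->
  measurable_fun D (fun y : 'rV[R]_n.+1 => (g (y ord0 ord0))).
Proof.
move=> mg; apply: measurable_funTS.
apply: (@measurableT_comp _ _ _ _ _ _ g) => //.
exact: measurable_coord.
Qed.

Lemma emeasurable_comp_coord0 (R : realType) n (D : set 'rV[R]_n.+1) (g : R -> R) :
  measurable_fun setT g ->
  measurable_fun D (fun y : 'rV[R]_n.+1 => (g (y ord0 ord0))%:E).
Proof.
by move=> mg; apply: (measurable_EFinP D _).2; exact: measurable_comp_coord0.
Qed.

(** Everything depends on the first coordinate alone, so an average over a cube
    is an average over the interval which is its first side. *)
Definition mean_le (R : realType) n (a : 'rV[R]_n.+1) (l : R) (g : R -> R)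
    (A : R) : Prop :=
  (cube_avg (cube a l) (fun y => (g (y ord0 ord0))%:E) <= A%:E)%E.

Section mean_le.
Variables (R : realType) (n : nat) (a : 'rV[R]_n.+1) (l : R).
Hypothesis l0 : 0 < l.
Local Notation I := `[a ord0 ord0, a ord0 ord0 + l].

Lemma mean_le_bound (g : R -> R) A : (forall x, x \in I -> 0 <= g x <= A) ->
  mean_le a l g A.
Proof.
move=> gA; rewrite /mean_le -(cube_avg_cst a A l0).
have gA' y : cube a l y -> 0 <= g (y ord0 ord0) <= A.
  by move=> ay; apply: gA; rewrite in_itv/=; exact: ay.
by apply: le_cube_avg => // y /gA' /andP[]; rewrite !lee_fin.
Qed.

Lemma mean_le_mono (g h : R -> R) A B : (forall x, x \in I -> 0 <= g x <= h x) ->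
  mean_le a l h A -> A <= B -> mean_le a l g B.
Proof.
move=> gh hA AB; apply: le_trans (_ : (A%:E <= B%:E)%E); last by rewrite lee_fin.
apply: le_trans hA.
have gh' y : cube a l y -> 0 <= g (y ord0 ord0) <= h (y ord0 ord0).
  by move=> ay; apply: gh; rewrite in_itv/=; exact: ay.
by apply: le_cube_avg => // y /gh' /andP[]; rewrite !lee_fin.
Qed.

Lemma mean_leD (g h : R -> R) A B : (forall x, 0 <= g x) -> (forall x, 0 <= h x) ->
  measurable_fun setT g -> measurable_fun setT h ->
  mean_le a l g A -> mean_le a l h B -> mean_le a l (g \+ h) (A + B).
Proof.
move=> g0 h0 mg mh gA hB; apply: le_trans (leeD gA hB).
rewrite !cube_avg_cubeE// -ge0_muleDr; [|by apply: integral_ge0 => *; rewrite lee_fin..].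
have mQ := measurable_cube a l.
rewrite -ge0_integralD//.
- by move=> *; rewrite lee_fin.
- exact: emeasurable_comp_coord0.
- by move=> *; rewrite lee_fin.
- exact: emeasurable_comp_coord0.
Qed.

Lemma mean_leZ (g : R -> R) A c : 0 <= c -> (forall x, 0 <= g x) ->
  measurable_fun setT g -> mean_le a l g A ->
  mean_le a l (fun x => c * g x) (c * A).
Proof.
move=> c0 g0 mg gA; rewrite /mean_le EFinM.
have mQ := measurable_cube a l.
have -> : cube_avg (cube a l) (fun y => (c * g (y ord0 ord0))%:E) =
    (c%:E * cube_avg (cube a l) (fun y => (g (y ord0 ord0))%:E))%E.
  rewrite !cube_avg_cubeE// [RHS]muleCA; congr (_ * _)%E.
  rewrite -ge0_integralZl//.
  - exact: emeasurable_comp_coord0.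
  - by move=> *; rewrite lee_fin.
by apply: lee_wpmul2l => //; rewrite lee_fin.
Qed.

Lemma mean_le_sum m (g : nat -> R -> R) (A : nat -> R) :
  (forall k x, 0 <= g k x) -> (forall k, measurable_fun setT (g k)) ->
  (forall k, (k < m)%N -> mean_le a l (g k) (A k)) ->
  mean_le a l (fun x => \sum_(0 <= k < m) g k x) (\sum_(0 <= k < m) A k).
Proof.
move=> g0 mg; elim: m => [|m IH] gA.
  by apply: mean_le_bound => x _; rewrite !big_nil lexx.
rewrite big_nat_recr//=; under eq_fun do rewrite big_nat_recr//=.
apply: mean_leD => //.
- by move=> x; apply: sumr_ge0.
- by apply: measurable_sum.
- by apply: IH => k km; apply: gA; rewrite ltnW.
- exact: gA.
Qed.

End mean_le.

(** * Averages of interval indicators *)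

(** If [D] is the distance from [c] to the farther endpoint of [[a, a + l]] and
    [X] the length of the overlap of this interval with [[c - rho, c + rho]],
    the claim is that the overlap fills at most a proportion
    [2 * min 1 (rho / D)].  When [l >= D] this follows from [X <= 2 * rho].
    When [l < D], the interval is the far end of the segment of length [D] from
    [c] to this endpoint, while [[c - rho, c + rho]] covers its near end; so the
    proportion is at most the one in the whole segment, [rho / D]. *)
Lemma overlap_le (R : realFieldType) (a l c rho D X : R) :
  0 < l -> 0 < rho -> D = Num.max `|a - c| `|a + l - c| ->
  X <= l -> X <= 2 * rho -> X <= a + l - (c - rho) -> X <= c + rho - a ->
  0 <= X ->
  X <= 2 * rho / Num.max rho D * l.
Proof.
move=> l0 rho0 DE X1 X2 X3 X4 X0.
have M0 : 0 < Num.max rho D by rewrite lt_max rho0.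
rewrite mulrAC ler_pdivlMr//.
have D1 : `|a - c| <= D by rewrite DE le_max lexx.
have D2 : `|a + l - c| <= D by rewrite DE le_max lexx orbT.
have [Dr|rD] := leP D rho.
  by nra.
have [Dl|lD] := leP D l; first by nra.
have [Da|Da] : D = a + l - c \/ D = c - a.
  move: D1 D2; rewrite !ler_norml => /andP[_ _] /andP[_ _].
  by move: DE; case: (leP `|a - c|); case: (ger0P (a + l - c));
    case: (ger0P (a - c)); lra.
- by nra.
- by nra.
Qed.

Definition ball_indic (R : realType) (c rho x : R) : R := (`|x - c| <= rho)%R%:R.

Lemma ball_indicE (R : realType) (c rho : R) :
  ball_indic c rho = \1_(`[c - rho, c + rho]%classic).
Proof.
apply/funext => x; rewrite /ball_indic indicE mem_setE in_itv/= ler_norml.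
by congr (_%:R); congr nat_of_bool; lra.
Qed.

Lemma ball_indic_ge0 (R : realType) (c rho x : R) : 0 <= ball_indic c rho x.
Proof. by []. Qed.

Lemma measurable_ball_indic (R : realType) (c rho : R) :
  measurable_fun setT (ball_indic c rho).
Proof. by rewrite ball_indicE; exact: measurable_indic. Qed.

Lemma cube_avg_indic (R : realType) n (a : 'rV[R]_n.+1) (l : R) (A : set R) :
  0 < l -> measurable A ->
  cube_avg (cube a l) (fun y => (\1_A (y ord0 ord0))%:E) =
  (l^-1%:E * lebesgue_measure
     (`[a ord0 ord0, (a ord0 ord0 + l)%R]%classic `&` A))%E.
Proof.
move=> l0 mA; rewrite cube_avg_cubeE//.
rewrite (eq_integral
  (fun y => (\1_((fun x : 'rV[R]_n.+1 => x ord0 ord0) @^-1` A) y)%:E)); last first.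
  by move=> y _; rewrite !indicE.
rewrite integral_indic; [|exact: measurable_cube|]; last first.
  by rewrite -[X in measurable X]setTI; apply: measurable_coord.
have -> : (fun x : 'rV[R]_n.+1 => x ord0 ord0) @^-1` A `&` cube a l =
    prism (n := n) (`[a ord0 ord0, (a ord0 ord0 + l)%R]%classic `&` A)
      (fun i : 'I_n => a ord0 (lift ord0 i)) l.
  rewrite cubeE; apply/seteqP; split => [x [Ax [ax bx]]|x [[ax Ax] bx]] //.
transitivity ((l ^+ n.+1)^-1%:E * (lebesgue_measure
     (`[a ord0 ord0, (a ord0 ord0 + l)%R]%classic `&` A) * (l ^+ n)%:E))%E.
  congr (_ * _)%E; apply: lebesgue_rV_prism; last exact: ltW.
  by apply: measurableI.
rewrite muleC -muleA muleC; congr (_ * _)%E.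
by rewrite -EFinM; congr EFin; rewrite exprS; field; rewrite expf_neq0// gt_eqF.
Qed.

Lemma mean_le_ball (R : realType) n (a : 'rV[R]_n.+1) (l c rho D : R) :
  0 < l -> 0 < rho ->
  D = Num.max `|a ord0 ord0 - c| `|a ord0 ord0 + l - c| ->
  mean_le a l (ball_indic c rho) (2 * rho / Num.max rho D).
Proof.
move=> l0 rho0 DE; rewrite /mean_le ball_indicE cube_avg_indic//.
set b := a ord0 ord0 in DE *.
rewrite -lee_pdivlMl ?invr_gt0// invrK -EFinM mulrC.
apply: (@le_trans _ _ (lebesgue_measure
    `[Num.max b (c - rho)%R, Num.min (b + l)%R (c + rho)%R]%classic)).
  apply: le_measure; rewrite ?inE; [exact: measurableI|exact: measurable_itv|].
  move=> x [] /=; rewrite !in_itv/= => /andP[b1 b2] /andP[b3 b4].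
  by rewrite ge_max le_min b1 b2 b3 b4.
have M0 : 0 < Num.max rho D by rewrite lt_max rho0.
rewrite lebesgue_measure_itv/= lte_fin; case: ltP => [|_]; last first.
  by rewrite lee_fin mulr_ge0 ?divr_ge0 ?mulr_ge0// ltW.
rewrite -EFinD lee_fin => lt.
have h1 : b <= Num.max b (c - rho) by rewrite le_max lexx.
have h2 : c - rho <= Num.max b (c - rho) by rewrite le_max lexx orbT.
have h3 : Num.min (b + l) (c + rho) <= b + l by rewrite ge_min lexx.
have h4 : Num.min (b + l) (c + rho) <= c + rho by rewrite ge_min lexx orbT.
by apply: overlap_le DE _ _ _ _ _ => //; lra.
Qed.

(** * The radial profile *)

(** A weight comparable to [1] for [|x - c| <= 1] and to [1 / (N * |x - c|)]
    beyond, until it vanishes at distance [4 ^ m.-1] from [c].  Written as a sum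
    of indicators of intervals, it has averages that reduce to lengths of
    overlaps. *)
Definition profile (R : realType) (N m : nat) (c x : R) : R :=
  ball_indic c 1 x + N%:R^-1 * \sum_(0 <= e < m) (4 ^+ e)^-1 * ball_indic c (4 ^+ e) x.

Section profile.
Variables (R : realType) (N : nat).
Hypothesis N0 : (0 < N)%N.
Implicit Types (c x D : R) (m k : nat).

Let NR0 : 0 < N%:R :> R. Proof. by rewrite ltr0n. Qed.
Let pow4_gt0 e : 0 < 4 ^+ e :> R. Proof. exact: exprn_gt0. Qed.
Let pow4_ge1 e : 1 <= 4 ^+ e :> R. Proof. by rewrite exprn_ege1// ler1n. Qed.

Lemma profile_ge0 m c x : 0 <= profile N m c x.
Proof.
rewrite addr_ge0 ?ball_indic_ge0// mulr_ge0 ?invr_ge0 ?(ltW NR0)//.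
by apply: sumr_ge0 => e _; rewrite mulr_ge0 ?invr_ge0 ?ball_indic_ge0// ltW.
Qed.

Lemma measurable_profile m c : measurable_fun setT (profile N m c).
Proof.
apply: measurable_funD; first exact: measurable_ball_indic.
apply: measurable_funM => //; apply: measurable_sum => e.
by apply: measurable_funM => //; exact: measurable_ball_indic.
Qed.

Lemma profile_bounded m c x : profile N m c x <= 1 + m%:R.
Proof.
have ind1 rho : ball_indic c rho x <= 1 by rewrite /ball_indic lern1 leq_b1.
apply: lerD => //.
apply: (@le_trans _ _ (\sum_(0 <= e < m) (4 ^+ e)^-1 * ball_indic c (4 ^+ e) x)).
  rewrite ler_piMl//; last by rewrite invf_le1// ler1n.
  by apply: sumr_ge0 => e _; rewrite mulr_ge0 ?invr_ge0 ?ball_indic_ge0// ltW.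
rewrite -[m in leRHS]subn0 -sumr_const_nat; apply: ler_sum => e _.
by rewrite -[leRHS]mulr1 ler_pM ?invr_ge0 ?ball_indic_ge0 ?(ltW (pow4_gt0 e))// invf_le1.
Qed.

Lemma profile_ge1 m c x : `|x - c| <= 1 -> 1 <= profile N m c x.
Proof.
move=> xc; rewrite /profile {1}/ball_indic xc lerDl mulr_ge0 ?invr_ge0 ?(ltW NR0)//.
by apply: sumr_ge0 => e _; rewrite mulr_ge0 ?invr_ge0 ?ball_indic_ge0// ltW.
Qed.

Lemma profile_supp k c x : 4 ^+ k < `|x - c| -> profile N k.+1 c x = 0.
Proof.
move=> kx; rewrite /profile /ball_indic leNgt (le_lt_trans (pow4_ge1 k) kx) add0r.
rewrite big_nat big1 ?mulr0// => e; rewrite andTb ltnS => ek.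
rewrite leNgt (le_lt_trans _ kx) ?mulr0//.
by rewrite ler_eXn2l// ltr1n.
Qed.

(** For [D > 1], the term of the smallest radius [4 ^ e >= D] suffices, as
    [4 ^ e <= 4 * D]. *)
Lemma profile_lower k c x D : `|x - c| <= D -> D <= 4 ^+ k ->
  (4 * N%:R * Num.max 1 D)^-1 <= profile N k.+1 c x.
Proof.
move=> xD Dk; have [D1|D1] := leP D 1.
  apply: le_trans (profile_ge1 _ (le_trans xD D1)); rewrite mulr1 invf_le1 ?mulr_gt0//.
  by rewrite -natrM ler1n muln_gt0 N0.
have exe : exists e, D <= 4 ^+ e by exists k.
case: (ex_minnP exe) => e De mine.
have ek : (e < k.+1)%N by rewrite ltnS mine.
have e4 : 4 ^+ e <= 4 * D.
  case: e De mine {ek} => [|e] De mine; first by rewrite expr0; lra.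
  rewrite exprS ler_pM2l// leNgt; apply/negP => De'.
  by have := mine e (ltW De'); rewrite ltnn.
apply: (@le_trans _ _ (N%:R^-1 * ((4 ^+ e)^-1 * ball_indic c (4 ^+ e) x))).
  rewrite /ball_indic (le_trans xD De) mulr1 -invfM lef_pV2 ?posrE ?mulr_gt0//; last lra.
  by have := ler_wpM2l (ltW NR0) e4; lra.
rewrite -[leLHS]add0r lerD ?ball_indic_ge0// ler_pM2l ?invr_gt0//.
rewrite big_mkord (bigD1 (Ordinal ek))//= lerDl.
by apply: sumr_ge0 => i _; rewrite mulr_ge0 ?invr_ge0 ?ball_indic_ge0// ltW.
Qed.

(** Each scale contributes at most [2 / (N * max 1 D)]; there are at most
    [N + 1] of them, so the factor [1 / N] keeps the average of the order of
    [1 / max 1 D], the average of the central interval alone.  Against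
    [profile_lower], this says that, on the intervals contained in its support,
    the profile is an A_1 weight of constant of the order of [N]. *)
Lemma profile_mean n (a : 'rV[R]_n.+1) (l : R) m c D :
  0 < l -> (m <= N.+1)%N ->
  D = Num.max `|a ord0 ord0 - c| `|a ord0 ord0 + l - c| ->
  mean_le a l (profile N m c) (6 / Num.max 1 D).
Proof.
move=> l0 mN DE.
have M0 r : 0 < r -> 0 < Num.max r D by move=> r0; rewrite lt_max r0.
have N1 : 1 <= N%:R :> R by rewrite ler1n.
apply: (@mean_le_mono _ _ _ _ l0 _ (profile N m c)
  (2 * 1 / Num.max 1 D + N%:R^-1 * \sum_(0 <= e < m) 2 / Num.max 1 D)).
- by move=> x _; rewrite profile_ge0 lexx.
- apply: mean_leD => //; [|exact: measurable_ball_indic| | |].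
  + move=> x; rewrite mulr_ge0 ?invr_ge0 ?(ltW NR0)//.
    by apply: sumr_ge0 => e _; rewrite mulr_ge0 ?invr_ge0 ?ball_indic_ge0// ltW.
  + apply: measurable_funM => //; apply: measurable_sum => e.
    by apply: measurable_funM => //; exact: measurable_ball_indic.
  + exact: mean_le_ball.
  apply: mean_leZ => //.
  + by move=> x; apply: sumr_ge0 => e _; rewrite mulr_ge0 ?invr_ge0 ?ball_indic_ge0// ltW.
  + apply: measurable_sum => e.
    by apply: measurable_funM => //; exact: measurable_ball_indic.
  apply: (mean_le_sum l0 (g := fun e x => (4 ^+ e)^-1 * ball_indic c (4 ^+ e) x)
            (A := fun=> 2 / Num.max 1 D)).
  + by move=> e x; rewrite mulr_ge0 ?invr_ge0 ?ball_indic_ge0// ltW.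
  + by move=> e; apply: measurable_funM => //; exact: measurable_ball_indic.
  move=> e _.
  apply: (@mean_le_mono _ _ _ _ l0 _ (fun x => (4 ^+ e)^-1 * ball_indic c (4 ^+ e) x)
    ((4 ^+ e)^-1 * (2 * 4 ^+ e / Num.max (4 ^+ e) D))).
  + by move=> x _; rewrite lexx andbT mulr_ge0 ?invr_ge0 ?ball_indic_ge0// ltW.
  + apply: mean_leZ => //; [exact: measurable_ball_indic|].
    exact: mean_le_ball.
  rewrite mulrA mulrCA mulVf ?gt_eqF// mulr1 ler_pM2l// lef_pV2 ?posrE ?M0//.
  by rewrite ge_max !le_max lexx pow4_ge1 orbT.
rewrite sumr_const_nat subn0 mulr1 -[(2 / _) *+ m]mulr_natr.
have m2 : N%:R^-1 * m%:R <= 2 :> R.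
  rewrite ler_pdivrMl//; apply: (@le_trans _ _ N.+1%:R); first by rewrite ler_nat.
  by rewrite -natr1; lra.
have M1 : 0 <= (Num.max 1 D)^-1 by rewrite invr_ge0 ltW// M0.
by have := ler_wpM2r M1 m2; lra.
Qed.

End profile.

(** * The weight and its averages on a cube *)

(** The dual weight away from the bumps; the constant keeps it positive
    beyond the distance [4 ^ N]. *)
Definition base (R : realType) (N : nat) (x : R) : R :=
  profile N N.+1 0 x + (N%:R * 4 ^+ N)^-1.

(** With this height, the total mass of the bump around [4 ^ k.+1] is about
    [N ^ q * 4 ^ (k.+1 * (q + 1))], hence its average over an interval of length
    [4 ^ k.+1] is comparable to the value of [base `^ (- q)] there. *)
Definition height (R : realType) (N : nat) (q : R) (k : nat) : R :=
  N%:R `^ q * (4 ^+ k.+1) `^ (q + 1).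

Definition bump (R : realType) (N : nat) (q : R) (k : nat) (x : R) : R :=
  height N q k * profile N k.+1 (4 ^+ k.+1) x.

Definition weight (R : realType) (N : nat) (q : R) (x : R) : R :=
  base N x `^ (- q) + \sum_(0 <= k < N) bump N q k x.

(** The distance from [c] to the farther endpoint of [[b, b + l]]. *)
Definition reach (R : realType) (b l c : R) : R :=
  Num.max `|b - c| `|b + l - c|.

(** Up to constants, [base] is at least [base_scale / N] on [[b, b + l]], with
    average at most [base_scale]. *)
Definition base_scale (R : realType) (N : nat) (b l : R) : R :=
  (Num.min (Num.max 1 (reach b l 0)) (4 ^+ N))^-1.

(** A lower bound on [[b, b + l]] for the sum of the bumps, to which only the
    bumps whose support contains this interval contribute. *)
Definition bump_floor (R : realType) (N : nat) (q b l : R) : R :=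
  \sum_(0 <= k < N) (reach b l (4 ^+ k.+1) <= 4 ^+ k)%R%:R *
    (height N q k / (4 * N%:R * Num.max 1 (reach b l (4 ^+ k.+1)))).

(** A geometric series is controlled by its last term. *)
Lemma sum_pow4_le (R : realFieldType) (m : nat) (y : R) : 0 <= y ->
  \sum_(0 <= k < m) (4 ^+ k.+1 <= y)%R%:R * 4 ^+ k.+1 <= 4 / 3 * y.
Proof.
move=> y0.
have pow4_gt0 e : 0 < 4 ^+ e :> R by exact: exprn_gt0.
have geo j : \sum_(0 <= k < j) (4 ^+ k.+1 <= y)%R%:R * 4 ^+ k.+1 <= 4 ^+ j.+1 / 3 :> R.
  elim: j => [|j IH]; first by rewrite big_nil divr_ge0.
  rewrite big_nat_recr//= [4 ^+ j.+2]exprS.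
  have := pow4_gt0 j.+1.
  by case: (_ <= y) => /=; lra.
elim: m => [|m IH]; first by rewrite big_nil mulr_ge0// divr_ge0.
rewrite big_nat_recr//=; case: (leP (4 ^+ m.+1) y) => /= [my|_]; last lra.
by have := geo m; lra.
Qed.

Lemma powRN_le (R : realType) (t x y : R) : 0 <= t -> 0 < x -> x <= y ->
  y `^ (- t) <= x `^ (- t).
Proof.
move=> t0 x0 xy; have y0 := lt_le_trans x0 xy.
rewrite !powRN lef_pV2 ?posrE ?powR_gt0//.
by apply: ge0_ler_powR => //; rewrite ?nnegrE ltW.
Qed.

Section weight.
Variables (R : realType) (N : nat) (q : R).
Hypotheses (N0 : (0 < N)%N) (q1 : 1 <= q).
Implicit Types (x D : R) (k : nat).

Let NR0 : 0 < N%:R :> R. Proof. by rewrite ltr0n. Qed.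
Let NR1 : 1 <= N%:R :> R. Proof. by rewrite ler1n. Qed.
Let pow4_gt0 e : 0 < 4 ^+ e :> R. Proof. exact: exprn_gt0. Qed.
Let pow4_ge1 e : 1 <= 4 ^+ e :> R. Proof. by rewrite exprn_ege1// ler1n. Qed.
Let q0 : 0 < q. Proof. by rewrite (lt_le_trans _ q1). Qed.

Lemma base_ge x : (N%:R * 4 ^+ N)^-1 <= base N x.
Proof. by rewrite lerDr profile_ge0. Qed.

Lemma base_gt0 x : 0 < base N x.
Proof. by apply: lt_le_trans (base_ge x); rewrite invr_gt0 mulr_gt0. Qed.

Lemma measurable_base : measurable_fun setT (@base R N).
Proof. by apply: measurable_funD => //; exact: measurable_profile. Qed.

Lemma height_gt0 k : 0 < height N q k.
Proof. by rewrite mulr_gt0// powR_gt0. Qed.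

Lemma bump_ge0 k x : 0 <= bump N q k x.
Proof. by rewrite mulr_ge0 ?profile_ge0// ltW// height_gt0. Qed.

Lemma measurable_bump k : measurable_fun setT (bump N q k).
Proof. by apply: measurable_funM => //; exact: measurable_profile. Qed.

Lemma measurable_bumps :
  measurable_fun setT (fun x => \sum_(0 <= k < N) bump N q k x).
Proof. by apply: measurable_sum => k; exact: measurable_bump. Qed.

Lemma bumps_ge0 x : 0 <= \sum_(0 <= k < N) bump N q k x.
Proof. by apply: sumr_ge0 => k _; exact: bump_ge0. Qed.

Lemma measurable_base_powR : measurable_fun setT (fun x : R => base N x `^ (- q)).
Proof.
apply: (@measurableT_comp _ _ _ _ _ _ (fun y : R => y `^ (- q)) _ (@base R N)).
  exact: measurable_powR.
exact: measurable_base.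
Qed.

Lemma measurable_weight : measurable_fun setT (weight N q).
Proof. exact: measurable_funD measurable_base_powR measurable_bumps. Qed.

Lemma weight_gt0 x : 0 < weight N q x.
Proof. by rewrite ltr_wpDr ?bumps_ge0// powR_gt0// base_gt0. Qed.

Lemma weight_bounded : exists B : R, forall x, weight N q x <= B.
Proof.
exists ((N%:R * 4 ^+ N)^-1 `^ (- q) +
  \sum_(0 <= k < N) height N q k * (1 + k.+1%:R)) => x.
apply: lerD; first by rewrite powRN_le ?base_ge ?ltW// invr_gt0 mulr_gt0.
by apply: ler_sum => k _; rewrite ler_pM2l ?height_gt0// profile_bounded.
Qed.

Section interval.
Variables (n : nat) (a : 'rV[R]_n.+1) (l : R).
Hypothesis l0 : 0 < l.
Local Notation b := (a ord0 ord0).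
Local Notation r := (reach b l 0).
Local Notation s := (base_scale N b l).
Local Notation D k := (reach b l (4 ^+ k.+1)).

Let r_gt0 : 0 < r.
Proof.
rewrite lt_max !subr0 !normr_gt0.
by have [->|//] := eqVneq b 0; rewrite add0r gt_eqF.
Qed.

Let s_gt0 : 0 < s.
Proof. by rewrite invr_gt0 lt_min pow4_gt0 lt_max ltr01. Qed.

Let itv_r x : b <= x <= b + l -> `|x| <= r.
Proof.
move=> /andP[bx xb]; rewrite le_max !subr0.
have := ler_norm (- b); rewrite normrN => Nb; have := ler_norm (b + l) => bl.
by apply/orP; case: (ler0P x) => _; [left|right]; lra.
Qed.

Let itv_D k x : b <= x <= b + l -> `|x - 4 ^+ k.+1| <= D k.
Proof.
move=> /andP[bx xb]; rewrite le_max.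
have := ler_norm (- (b - 4 ^+ k.+1)); rewrite normrN => Nb.
have := ler_norm (b + l - 4 ^+ k.+1) => bl.
by apply/orP; case: (ler0P (x - _)) => _; [left|right]; lra.
Qed.

Lemma base_mean : mean_le a l (base N) (7 * s).
Proof.
have sr : (Num.max 1 r)^-1 <= s.
  by rewrite lef_pV2 ?posrE ?ge_min ?lexx// ?lt_min ?pow4_gt0 lt_max ltr01.
have sN : (N%:R * 4 ^+ N)^-1 <= s.
  rewrite lef_pV2 ?posrE ?mulr_gt0// ?lt_min ?pow4_gt0 ?lt_max ?ltr01//.
  rewrite ge_min; apply/orP; right.
  by rewrite -[leLHS]mul1r ler_pM2r.
apply: (@mean_le_mono _ _ _ _ l0 _ (base N)
   (6 / Num.max 1 r + (N%:R * 4 ^+ N)^-1)); last 1 first.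
- by move: sr sN; set u := (_^-1); set v := _^-1; lra.
- by move=> x _; rewrite lexx (ltW (base_gt0 x)).
- apply: mean_leD => //; [exact: profile_ge0|exact: measurable_profile| |].
  + exact: profile_mean.
  + by apply: mean_le_bound => // x _; rewrite lexx invr_ge0 mulr_ge0// ltW.
Qed.

Lemma base_lower x : b <= x <= b + l -> s / (4 * N%:R) <= base N x.
Proof.
move=> /itv_r xr; have [r4|r4] := leP r (4 ^+ N).
  apply: le_trans (_ : _ <= profile N N.+1 0 x) _; last first.
    by rewrite lerDl invr_ge0 mulr_ge0// ltW.
  rewrite -[x]subr0 in xr; apply: le_trans (profile_lower N0 xr r4).
  rewrite -invfM lef_pV2 ?posrE ?mulr_gt0 ?lt_min ?lt_max ?ltr01 ?pow4_gt0//.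
  have : Num.max 1 r <= Num.min (Num.max 1 r) (4 ^+ N).
    by rewrite le_min lexx ge_max r4 pow4_ge1.
  by have p : 0 <= 4 * N%:R :> R by []; move=> /(ler_wpM2l p); lra.
apply: le_trans (base_ge x).
rewrite -invfM lef_pV2 ?posrE ?mulr_gt0// ?lt_min ?lt_max ?ltr01 ?pow4_gt0//.
have -> : Num.min (Num.max 1 r) (4 ^+ N) = 4 ^+ N.
  by apply/min_idPr; rewrite le_max (ltW r4) orbT.
have : 0 < 4 ^+ N * N%:R :> R by rewrite mulr_gt0.
by lra.
Qed.

(** The infimum of a sum is at least the sum of the infima, whatever the
    position of the supports; a sum of A_1 weights is thus an A_1 weight of the
    same constant. *)
Lemma bump_lower x : b <= x <= b + l ->
  bump_floor N q b l <= \sum_(0 <= k < N) bump N q k x.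
Proof.
move=> bx; apply: ler_sum => k _.
have [Dk|_] := leP (D k) (4 ^+ k); last by rewrite mul0r bump_ge0.
rewrite mul1r ler_pM2l ?height_gt0//.
exact: profile_lower (itv_D k bx) Dk.
Qed.

(** Either the support of the bump contains the interval, and the bump behaves
    on it as an A_1 weight; or the interval reaches about as far from the centre
    of the bump as from the origin, which gives the second term; or the bump
    vanishes on the interval. *)
Lemma bump_mean k : (k < N)%N -> mean_le a l (bump N q k)
  ((D k <= 4 ^+ k)%R%:R * (24 * N%:R * (height N q k / (4 * N%:R * Num.max 1 (D k))))
   + (4 ^+ k.+1 <= 2 * r)%R%:R * (height N q k * (48 / r))).
Proof.
move=> kN.
have h0 := height_gt0 k.
have M0 : 0 < Num.max 1 (D k) by rewrite lt_max ltr01.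
have mean : mean_le a l (bump N q k) (height N q k * (6 / Num.max 1 (D k))).
  apply: mean_leZ => //; [exact: ltW|exact: profile_ge0|exact: measurable_profile|].
  by apply: profile_mean => //; rewrite ltnW.
have bump_refl x : x \in `[b, b + l] -> 0 <= bump N q k x <= bump N q k x.
  by rewrite lexx bump_ge0.
have t2 : 0 <= (4 ^+ k.+1 <= 2 * r)%R%:R * (height N q k * (48 / r)).
  by rewrite mulr_ge0// mulr_ge0 ?(ltW h0)// divr_ge0// ltW.
have [Dk|Dk] := leP (D k) (4 ^+ k).
  apply: (mean_le_mono l0 bump_refl mean).
  rewrite mul1r; apply: le_trans
    (_ : 24 * N%:R * (height N q k / (4 * N%:R * Num.max 1 (D k))) <= _);
    last by rewrite lerDl.
  rewrite le_eqVlt; apply/orP; left; apply/eqP; field.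
  by rewrite !gt_eqF.
rewrite mul0r add0r.
have [kr|kr] := leP (4 ^+ k.+1) (2 * r).
  rewrite mul1r; apply: (mean_le_mono l0 bump_refl mean).
  rewrite ler_pM2l// ler_pdivrMr// mulrAC ler_pdivlMr//.
  have : D k <= Num.max 1 (D k) by rewrite le_max lexx orbT.
  (* Far from the origin, [D k >= r - 4 ^ k.+1 >= r / 2]; otherwise
     [r < 2 * 4 ^ k.+1 < 8 * D k], as the support does not contain the
     interval. *)
  suff : r <= 8 * D k by lra.
  have [r2|r2] := leP (2 * 4 ^+ k.+1) r; last first.
    by move: r2 Dk; rewrite exprS; lra.
  have : r - 4 ^+ k.+1 <= D k; last by move: r2; lra.
  rewrite /reach !subr0; have p4 := pow4_gt0 k.+1.
  rewrite lerBlDr ge_max; apply/andP; split.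
    rewrite -[X in `|X| <= _](subrK (4 ^+ k.+1)) (le_trans (ler_normD _ _))//.
    by rewrite (gtr0_norm p4) lerD2r le_max lexx.
  rewrite -[X in `|X| <= _](subrK (4 ^+ k.+1)) (le_trans (ler_normD _ _))//.
  by rewrite (gtr0_norm p4) lerD2r le_max lexx orbT.
rewrite mul0r; apply: mean_le_bound => // x; rewrite in_itv/= => /itv_r xr.
rewrite /bump profile_supp ?mulr0 ?lexx//.
rewrite distrC; apply: lt_le_trans (ler_norm _).
by move: kr xr; rewrite exprS ler_norml => kr /andP[_ xr]; have := pow4_gt0 k; lra.
Qed.

(** The total average of the bumps whose support does not contain the interval,
    against the average of [base].  One has [4 ^ k.+1 * base_scale <= 2]
    for every [k < N] with [4 ^ k.+1 <= 2 * r], where [r] is the reach from the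
    origin.  This leaves the geometric series of these [4 ^ k.+1], of sum at
    most [8 / 3 * r]. *)
Lemma far_bumps : (\sum_(0 <= k < N) (4 ^+ k.+1 <= 2 * r)%R%:R *
    (height N q k * (48 / r))) * (7 * s) `^ q <= 128 * 14 `^ q * N%:R `^ q.
Proof.
rewrite mulr_suml.
apply: (@le_trans _ _ (\sum_(0 <= k < N) (N%:R `^ q * 14 `^ q * (48 / r)) *
    ((4 ^+ k.+1 <= 2 * r)%R%:R * 4 ^+ k.+1))); last first.
  rewrite -mulr_sumr.
  apply: le_trans (ler_wpM2l _ (sum_pow4_le N (y := 2 * r) _)) _.
  - by rewrite !mulr_ge0 ?powR_ge0// invr_ge0 ltW.
  - by rewrite mulr_ge0// ltW.
  by rewrite le_eqVlt; apply/orP; left; apply/eqP; field; rewrite gt_eqF.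
apply: ler_sum_nat => k; rewrite andTb => kN.
have [kr|_] := leP (4 ^+ k.+1) (2 * r); last by rewrite !mul0r mulr0.
rewrite !mul1r /height powRD; last by rewrite (gt_eqF (pow4_gt0 _)) implybT.
rewrite powRr1; last exact: ltW.
have s4 : 4 ^+ k.+1 * (7 * s) <= 14.
  suff : 4 ^+ k.+1 * s <= 2 by lra.
  rewrite ler_pdivrMr; last by rewrite lt_min pow4_gt0 lt_max ltr01.
  have k4N : 4 ^+ k.+1 <= 4 ^+ N :> R by rewrite ler_eXn2l// ltr1n.
  have rM : r <= Num.max 1 r by rewrite le_max lexx orbT.
  by have := pow4_gt0 N; have [_|_] := leP (Num.max 1 r) (4 ^+ N); lra.
have := @ge0_ler_powR _ q (ltW q0) (4 ^+ k.+1 * (7 * s)) 14.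
rewrite !nnegrE !mulr_ge0 ?(ltW (pow4_gt0 _)) ?(ltW s_gt0)// => /(_ isT (ler0n _ _) s4).
rewrite powRM ?mulr_ge0 ?(ltW (pow4_gt0 _)) ?(ltW s_gt0)// => le14.
set P := (4 ^+ k.+1) `^ q in le14 *; set S := (7 * s) `^ q in le14 *.
set c := (N%:R `^ q); set E := 4 ^+ k.+1.
have -> : c * (P * E) * (48 / r) * S = (c * E * (48 / r)) * (P * S) by ring.
have -> : c * 14 `^ q * (48 / r) * E = (c * E * (48 / r)) * 14 `^ q by ring.
apply: ler_wpM2l le14.
by rewrite !mulr_ge0 ?powR_ge0 ?invr_ge0 ?(ltW r_gt0) ?(ltW (pow4_gt0 _)).
Qed.

End interval.
End weight.

(** * The A_p constant of the weight *)

(** The three terms come from [base `^ (- q)], from the bumps containing the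
    interval, and from the other bumps. *)
Definition Ap_factor (R : realType) (q : R) : R :=
  28 `^ q + 24 + 128 * 14 `^ q.

Section weight_Ap.
Variables (R : realType) (N : nat) (q : R).
Hypotheses (N0 : (0 < N)%N) (q1 : 1 <= q).

Let NR0 : 0 < N%:R :> R. Proof. by rewrite ltr0n. Qed.
Let NR1 : 1 <= N%:R :> R. Proof. by rewrite ler1n. Qed.
Let q0 : 0 < q. Proof. by rewrite (lt_le_trans _ q1). Qed.

Lemma dual_weight_le_base x : weight N q x `^ (- q^-1) <= base N x.
Proof.
have b0 := @base_gt0 R N N0 x.
apply: (@le_trans _ _ ((base N x `^ (- q)) `^ (- q^-1))).
  rewrite powRN_le ?invr_ge0 ?(ltW q0) ?powR_gt0//.
  by rewrite lerDl bumps_ge0.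
by rewrite -powRrM mulrNN divff ?gt_eqF// powRr1// ltW.
Qed.

Lemma bump_floor_ge0 (b l : R) : 0 <= bump_floor N q b l.
Proof.
apply: sumr_ge0 => k _; rewrite mulr_ge0// divr_ge0 ?(ltW (height_gt0 _ _ _))//.
by rewrite mulr_ge0// le_max ler01.
Qed.

(** The average [B] of the dual weight is bounded in two ways, by the average of
    [base] and, where the bumps are at least [beta], by a negative power of
    [beta].  The average of the weight is split into three parts, each of
    which is multiplied by [B `^ q] with the more favourable bound.  The part of
    the containing bumps costs only the A_1 constant [24 * N], and
    [N <= N `^ q] because [q >= 1]: this is where [p >= 2] enters. *)
Lemma weight_cube_Ap n (a : 'rV[R]_n.+1) (l : R) : 0 < l ->
  (cube_avg (cube a l) (fun y => (weight N q (y ord0 ord0))%:E) *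
   cube_avg (cube a l) (fun y => (weight N q (y ord0 ord0) `^ (- q^-1))%:E) `^ q
   <= (Ap_factor q * N%:R `^ q)%:E)%E.
Proof.
move=> l0; set b := a ord0 ord0.
set s := base_scale N b l; set beta := bump_floor N q b l.
have s0 : 0 < s.
  by rewrite invr_gt0 lt_min lt_max ltr01 exprn_gt0.
have beta0 : 0 <= beta := bump_floor_ge0 b l.
set sN := s / (4 * N%:R).
have sN0 : 0 < sN by rewrite divr_gt0// mulr_gt0.
set A2 := \sum_(0 <= k < N) (4 ^+ k.+1 <= 2 * reach b l 0)%R%:R *
    (height N q k * (48 / reach b l 0)).
have meanw : mean_le a l (weight N q) (sN `^ (- q) + (24 * N%:R * beta + A2)).
  apply: mean_leD => //.
  - by move=> x; rewrite powR_ge0.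
  - by move=> x; exact: bumps_ge0.
  - exact: measurable_base_powR.
  - exact: measurable_bumps.
  - apply: mean_le_bound => // x; rewrite in_itv/= => xI.
    by rewrite powR_ge0 powRN_le// ?(ltW q0)//; exact: base_lower.
  rewrite mulr_sumr -big_split/=.
  apply: (mean_le_sum l0 (g := bump N q)).
  + by move=> k x; exact: bump_ge0.
  + by move=> k; exact: measurable_bump.
  move=> k kN; apply: (@mean_le_mono _ _ _ _ l0 _ (bump N q k) _ _ _
    (bump_mean q N0 a l0 kN)).
    by move=> x _; rewrite lexx bump_ge0.
  by rewrite lerD2r mulrCA.
set X := cube_avg (cube a l) (fun y => (weight N q (y ord0 ord0) `^ (- q^-1))%:E).
have X0 : (0 <= X)%E by apply: cube_avg_ge0 => // y _; rewrite lee_fin powR_ge0.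
have Xs : (X <= (7 * s)%:E)%E.
  apply: (mean_le_mono l0 (g := fun x => weight N q x `^ (- q^-1)) _
    (base_mean N0 a l0)) => //.
  by move=> x _; rewrite powR_ge0 dual_weight_le_base.
have Xfin : X \is a fin_num by rewrite ge0_fin_numE// (le_lt_trans Xs)// ltry.
have [B XE] : exists B, X = B%:E by exists (fine X); rewrite fineK.
move: X0 Xs; rewrite XE !lee_fin => B0 Bs.
have Bqs : B `^ q <= (7 * s) `^ q.
  by apply: ge0_ler_powR => //; rewrite ?nnegrE ?(ltW q0) ?mulr_ge0 ?(ltW s0).
have part0 : sN `^ (- q) * B `^ q <= 28 `^ q * N%:R `^ q.
  rewrite powRN mulrC ler_pdivrMr ?powR_gt0//; apply: (le_trans Bqs).
  rewrite -!powRM ?mulr_ge0 ?(ltW sN0) ?(ltW s0)//; rewrite le_eqVlt; apply/orP; left.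
  by apply/eqP; congr (_ `^ _); rewrite /sN; field; rewrite gt_eqF.
have part1 : 24 * N%:R * beta * B `^ q <= 24 * N%:R `^ q.
  apply: (@le_trans _ _ (24 * N%:R)); last first.
    by rewrite ler_pM2l// le1r_powR.
  have [->|beta_neq0] := eqVneq beta 0; first by rewrite mulr0 mul0r mulr_ge0.
  have beta_gt0 : 0 < beta by rewrite lt_def beta_neq0.
  suff : B `^ q <= beta^-1.
    move=> h; rewrite -[leRHS]mulr1 -mulrA ler_pM2l ?mulr_gt0// mulrC.
    by rewrite -ler_pdivlMr// mul1r.
  have BB : B <= beta `^ (- q^-1).
    rewrite -lee_fin -XE.
    apply: (mean_le_bound l0 (g := fun x => weight N q x `^ (- q^-1))).
    move=> x; rewrite in_itv/= => xI; rewrite powR_ge0 powRN_le ?invr_ge0 ?(ltW q0)//.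
    apply: le_trans (bump_lower q N0 xI) _.
    by rewrite lerDr powR_ge0.
  have -> : beta^-1 = (beta `^ (- q^-1)) `^ q.
    by rewrite -powRrM mulNr mulVf ?gt_eqF// powR_inv1.
  by apply: ge0_ler_powR => //; rewrite ?nnegrE ?(ltW q0) ?powR_ge0.
have part2 : A2 * B `^ q <= 128 * 14 `^ q * N%:R `^ q.
  apply: le_trans (far_bumps N q1 a l0).
  apply: (ler_wpM2l _ Bqs); apply: sumr_ge0 => k _.
  rewrite mulr_ge0// mulr_ge0 ?(ltW (height_gt0 _ _ _))// divr_ge0//.
  by rewrite le_max normr_ge0.
rewrite poweR_EFin.
apply: le_trans (lee_wpmul2r _ meanw) _; first by rewrite lee_fin powR_ge0.
rewrite -EFinM lee_fin /Ap_factor.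
have -> : (sN `^ (- q) + (24 * N%:R * beta + A2)) * B `^ q =
  sN `^ (- q) * B `^ q + 24 * N%:R * beta * B `^ q + A2 * B `^ q by ring.
by move: part0 part1 part2; lra.
Qed.

Lemma weight_Ap_const n (p : R) : p - 1 = q ->
  (Ap_const p (fun y : 'rV[R]_n.+1 => weight N q (y ord0 ord0))
   <= (Ap_factor q * N%:R `^ q)%:E)%E.
Proof.
move=> pq; apply: ge_ereal_sup => _ [Q [a [l [l0 QE]]] <-].
rewrite pq.
rewrite (_ : Q = cube a l)//.
rewrite (_ : (fun y : 'rV[R]_n.+1 => (((weight N q (y ord0 ord0))%:E `^ q^-1)^-1)%E) =
  (fun y => (weight N q (y ord0 ord0) `^ (- q^-1))%:E)).
  exact: weight_cube_Ap.
apply/funext => y.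
by rewrite poweR_EFin inver powR_eq0 gt_eqF ?weight_gt0//= powRN.
Qed.

End weight_Ap.

(** * Bounded weights *)

Lemma coord_le_norm (R : realType) n (x : 'rV[R]_n.+1) i : `|x ord0 i| <= `|x|.
Proof.
rewrite [leRHS]/Num.norm/= mx_normrE.
exact: (le_bigmax_cond _ (fun ij : (ordinal 1 * ordinal n.+1)%type =>
  `|x ij.1 ij.2|) (j := (ord0, i))).
Qed.

Lemma compact_sub_cube (R : realType) n (K : set 'rV[R]_n.+1) : compact K ->
  exists a l, 0 < l /\ K `<=` cube a l.
Proof.
move=> /compact_bounded[M [_ MK]].
(* The bound on the norm holds only beyond [M]. *)
pose m := `|M| + 1.
have m0 : 0 < m by rewrite ltr_wpDl.
exists (\row_i - m), (2 * m); split; first by rewrite mulr_gt0.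
move=> x Kx i; rewrite mxE.
have : `|x| <= m by apply: (MK m _ x Kx); rewrite (le_lt_trans (ler_norm M))// ltrDl.
move=> /(le_trans (coord_le_norm x i)); rewrite ler_norml; lra.
Qed.

Lemma bounded_scalar_weight (R : realType) n (w : 'rV[R]_n.+1 -> R) (B : R) :
  measurable_fun setT w -> (forall x, 0 <= w x <= B) -> scalar_weight w.
Proof.
move=> mw wB.
have w0 x : 0 <= w x by case/andP: (wB x).
have wleB x : w x <= B by case/andP: (wB x).
split => //; split => // K /compact_sub_cube[a [l [l0 Kal]]].
have B0 : 0 <= B := le_trans (w0 0) (wleB 0).
apply: (@le_lt_trans _ _ (\int[lebesgue_rV n.+1]_(x in cube a l) B%:E)%E).
  rewrite integral_mkcond [leRHS]integral_mkcond.
  apply: ge0_le_integral_nonmeasurable => x _; rewrite /patch.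
    by case: ifP.
  case: ifPn => [/set_mem/Kal/mem_set ->|_].
    by rewrite lee_fin ger0_norm.
  by case: ifP; rewrite lee_fin.
rewrite integral_cst; last exact: measurable_cube.
by rewrite /= lebesgue_rV_cube ?(ltW l0)// -EFinM ltry.
Qed.

Lemma weight_scalar_weight (R : realType) (N n : nat) (q : R) :
  (0 < N)%N -> 1 <= q ->
  scalar_weight (fun y : 'rV[R]_n.+1 => weight N q (y ord0 ord0)).
Proof.
move=> N0 q1; have [B wB] := weight_bounded N0 q1.
apply: (@bounded_scalar_weight _ _ _ B).
  by apply: measurable_comp_coord0; exact: measurable_weight.
by move=> x; rewrite wB (ltW (weight_gt0 q N0 _)).
Qed.

(** * Lower bounds for the weak-type norm *)

Lemma Lnorm_indic d (T : measurableType d) (R : realType)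
    (mu : {measure set T -> \bar R}) (F : set T) (p : R) :
  p != 0 -> measurable F ->
  'N[mu]_p%:E[EFin \o (\1_F : T -> R)]%E = (mu F `^ p^-1)%E.
Proof.
move=> p0 mF; rewrite unlock; congr (_ `^ _)%E.
rewrite (eq_integral (fun x => (\1_F x)%:E)).
  by rewrite integral_indic// setIT.
move=> x _ /=; rewrite ger0_norm// indicE.
by case: (_ \in F); rewrite ?powR1 ?powR0.
Qed.

Lemma indic_Lfun d (T : measurableType d) (R : realType)
    (mu : {measure set T -> \bar R}) (F : set T) (p : R) :
  p != 0 -> measurable F -> (mu F < +oo)%E -> \1_F \in Lfun mu p%:E.
Proof.
move=> p0 mF Foo; apply/andP; split; rewrite inE.
  exact: measurable_indic.
by rewrite /finite_norm /= Lnorm_indic// poweR_lty.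
Qed.

(** Testing the weak-type inequality on the indicator of [F], at the level [a]
    which [T] exceeds on [E]. *)
Lemma weak_opnorm_ge (R : realType) d (p : R)
    (T : ('rV[R]_d -> R) -> 'rV[R]_d -> \bar R) (E F : set 'rV[R]_d)
    (a m V : R) : 0 < p -> 0 < a -> 0 <= m -> 0 < V ->
  measurable F -> lebesgue_rV d F = V%:E -> ((m * V)%:E <= lebesgue_rV d E)%E ->
  (forall x, E x -> (a%:E < T (\1_F) x)%E) ->
  ((a * m `^ p^-1)%:E <= weak_opnorm p T)%E.
Proof.
move=> p0 a0 m0 V0 mF FV EV ET.
apply: le_ereal_inf_tmp => _ [K [K0 HK] <-].
have pN0 : p != 0 by rewrite gt_eqF.
have := HK (\1_F) (indic_Lfun pN0 mF _); rewrite Lnorm_indic//.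
rewrite [X in (X < +oo)%E]FV [X in (X `^ _)%E]FV ltry => /(_ isT) weak.
have Vp : 0 < V `^ p^-1 by rewrite powR_gt0.
rewrite lee_fin -(ler_pM2r Vp) -lee_fin [X in (_ <= X)%E]EFinM.
apply: le_trans weak; apply: le_ereal_sup_tmp.
exists (a%:E * lebesgue_rV d [set x | (a%:E < `|T (\1_F) x|)%E] `^ p^-1)%E.
  by exists a.
rewrite -mulrA -powRM ?(ltW V0)// EFinM -poweR_EFin.
apply: lee_wpmul2l; first by rewrite lee_fin ltW.
have mV0 : (0 <= (m * V)%:E)%E by rewrite lee_fin mulr_ge0// ltW.
have EE : E `<=` [set x | (a%:E < `|T (\1_F) x|)%E].
  by move=> x /ET /lt_le_trans; apply; exact: lee_abs.
have le := le_trans EV (le_lebesgue_rV EE).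
apply: gt0_ler_poweR => //; first by rewrite invr_ge0 ltW.
- by rewrite in_itv/= mV0 leey.
- by rewrite in_itv/= leey andbT (le_trans mV0).
Qed.

(** The slab [F] is long in the directions orthogonal to the first axis, so that
    a cube of side [s <= L] containing [x] and starting on the hyperplane of
    equation [y_0 = 0] can be chosen with its other sides inside those of [F].
    It meets [F] in a proportion [1 / s], as in dimension one, where the weight
    is at most [1]. *)
Lemma maximal_weighted_ge (R : realType) n (w : R -> R) (p L s : R)
    (x : 'rV[R]_n.+1) : 0 < p -> (forall y, 0 <= w y) ->
  (forall y, 0 <= y <= 1 -> w y <= 1) -> 1 <= s -> s <= L ->
  0 <= x ord0 ord0 <= s -> (forall i, 0 <= x ord0 (lift ord0 i) <= L) ->
  ((w (x ord0 ord0) `^ p^-1 / s)%:E <= maximal_weighted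
    (fun y => w (y ord0 ord0)) p
    (\1_(prism (n := n) `[0%R, 1%R]%classic (fun=> 0%R) L)) x)%E.
Proof.
move=> p0 w0 w1 s1 sL x0s xL.
have s0 : 0 < s by rewrite (lt_le_trans _ s1).
(* The corner of the cube: in each of the other directions the side is
   [[x_i, x_i + s]], moved back when it would leave [[0, L]]. *)
pose a : 'rV[R]_n.+1 :=
  \row_i oapp (fun j => Num.min (x ord0 (lift ord0 j)) (L - s)) 0 (unlift ord0 i).
have a0 : a ord0 ord0 = 0 by rewrite mxE unlift_none.
have aE i : a ord0 (lift ord0 i) = Num.min (x ord0 (lift ord0 i)) (L - s).
  by rewrite mxE liftK.
have Qx : cube a s x.
  move=> i; case: (unliftP ord0 i) => [j ->|->]; last by rewrite a0 add0r.
  have /andP[xj0 xjL] := xL j; rewrite aE; apply/andP.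
  by have [xj|xj] := leP (x ord0 (lift ord0 j)) (L - s); split; lra.
set F := prism _ _ _.
pose G := prism (n := n) `[0%R, 1%R]%classic (fun i : 'I_n => a ord0 (lift ord0 i)) s.
have mG : measurable G by exact: measurable_prism.
have GF : G `<=` F.
  move=> y [y0 ya]; split => // i.
  have /andP[xi0 xiL] := xL i; have /andP[] := ya i; rewrite aE => y1 y2.
  apply/andP; move: y1 y2.
  by have [xi|xi] := leP (x ord0 (lift ord0 i)) (L - s); split; lra.
have GQ : G `<=` cube a s.
  move=> y [+ ya]; rewrite /= in_itv/= => /andP[y0 y1] i.
  case: (unliftP ord0 i) => [j ->|->]; first exact: ya.
  by rewrite a0 y0 add0r (le_trans y1).
apply: le_trans (ereal_sup_ubound _); last first.
  exists (cube a s); last reflexivity.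
  by split => //; exists a, s.
set u := w (x ord0 ord0) `^ p^-1.
have u0 : 0 <= u by rewrite powR_ge0.
apply: le_trans (_ : _ <= cube_avg (cube a s) (fun y => u%:E * (\1_G y)%:E))%E _.
  have mQ := measurable_cube a s.
  have m1G : measurable_fun (cube a s) (fun y => (\1_G y : R)%:E).
    by apply: measurable_funTS; apply/measurable_EFinP; exact: measurable_indic.
  rewrite cube_avg_cubeE// ge0_integralZl//.
  rewrite integral_indic//.
  rewrite (_ : G `&` _ = G); last by apply/setIidPl.
  rewrite [X in (_ <= _ * (_ * X))%E](_ : _ = (s ^+ n)%:E).
    rewrite -!EFinM lee_fin exprS le_eqVlt; apply/orP; left; apply/eqP; field.
    by rewrite expf_neq0 ?gt_eqF.
  transitivity (lebesgue_measure `[0%R : R, 1%R]%classic * (s ^+ n)%:E)%E.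
    by apply: lebesgue_rV_prism => //; exact: ltW.
  by have := @lebesgue_measure_segment R 0 1 ler01; rewrite add0r => ->; rewrite mul1e.
apply: le_cube_avg => // y Qy; first by rewrite -EFinM lee_fin mulr_ge0.
rewrite poweR_EFin -/u.
have inv0 : (0 <= ((w (y ord0 ord0) `^ p^-1)%:E)^-1)%E by rewrite inve_ge0 lee_fin powR_ge0.
rewrite [in leLHS]indicE; have [/set_mem Gy|_] := boolP (y \in G); last first.
  by rewrite mule0 mule_ge0// mule_ge0.
rewrite indicE mem_set; last exact: GF.
rewrite normr1 mule1 mule1 -[leLHS]mule1; apply: lee_wpmul2l => //.
rewrite inve_ge1; last by rewrite lee_fin powR_ge0.
have -> : 1%E = (1 `^ p^-1)%:E :> \bar R by rewrite powR1.
rewrite lee_fin; apply: ge0_ler_powR.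
- by rewrite invr_ge0 ltW.
- by rewrite nnegrE w0.
- by rewrite nnegrE.
- by apply: w1; case: Gy => + _; rewrite /= in_itv.
Qed.

(** On each of the [N] intervals of radius [1] around the points [4 ^ k.+1], the
    factor [w ^ (1 / p)] grows like [4 ^ k.+1] and compensates the decay
    [1 / 4 ^ k.+1] of the averages.  The level [N ^ (q / p) / 2] is therefore
    exceeded on a slab over the whole union, of measure [2 * N], and
    [N ^ (q / p) * N ^ (1 / p) = N]. *)
Lemma weight_weak_opnorm (R : realType) (N n : nat) (q p : R) :
  (0 < N)%N -> 1 <= q -> p = q + 1 ->
  ((N%:R / 2)%:E <= weak_opnorm p
     (maximal_weighted (fun y : 'rV[R]_n.+1 => weight N q (y ord0 ord0)) p))%E.
Proof.
move=> N0 q1 pq.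
have q0 : 0 < q by rewrite (lt_le_trans _ q1).
have p0 : 0 < p by rewrite pq addr_gt0.
have NR0 : 0 < N%:R :> R by rewrite ltr0n.
have pow4_gt0 e : 0 < 4 ^+ e :> R by exact: exprn_gt0.
have pow4_ge1 e : 1 <= 4 ^+ e :> R by rewrite exprn_ege1// ler1n.
(* Long enough for the largest cube, of side [4 ^ N + 1]. *)
pose L : R := 4 ^+ N + 1.
have L0 : 0 < L by rewrite addr_gt0.
pose J k : set R := `[4 ^+ k.+1 - 1, 4 ^+ k.+1 - 1 + 2]%classic.
pose E := prism (n := n) (\big[setU/set0]_(k < N) J k) (fun=> 0) L.
pose F := prism (n := n) `[0, 1]%classic (fun=> 0 : R) L.
have mJ k : measurable (J k) by exact: measurable_itv.
have mUJ : measurable (\big[setU/set0]_(k < N) J k).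
  by apply: bigsetU_measurable.
have trivJ : trivIset setT J.
  apply: ltn_trivIset => j k kj; apply/seteqP; split => // x [].
  rewrite /J /= !in_itv/= => /andP[x1 x2] /andP[x3 x4].
  have : 4 ^+ k.+2 <= 4 ^+ j.+1 :> R by rewrite ler_eXn2l// ltr1n.
  rewrite exprS => jk; have := pow4_ge1 k.+1; lra.
have muUJ : lebesgue_measure (\big[setU/set0]_(k < N) J k) = (2 * N%:R)%:E.
  transitivity (\sum_(k < N) (lebesgue_measure (J k)))%E.
    apply: measure_semi_additive_ord_I; [|exact: sub_trivIset trivJ|exact: mUJ].
    by move=> k _; exact: mJ.
  rewrite (eq_bigr (fun=> (2 : R)%:E)); last first.
    by move=> k _; exact: lebesgue_measure_segment.
  by rewrite sumEFin big_const_ord iter_addr_0 mulr_natr.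
have muE : lebesgue_rV n.+1 E = ((2 * N%:R) * L ^+ n)%:E.
  by rewrite lebesgue_rV_prism// ?(ltW L0)// muUJ -EFinM.
have muF : lebesgue_rV n.+1 F = (L ^+ n)%:E.
  rewrite lebesgue_rV_prism// ?(ltW L0)//.
  by have := @lebesgue_measure_segment R 0 1 ler01; rewrite add0r => ->; rewrite mul1e.
have mF : measurable F by apply: measurable_prism.
pose al := N%:R `^ (q / p) / 2.
have al0 : 0 < al by rewrite divr_gt0// powR_gt0.
have -> : N%:R / 2 = al * N%:R `^ p^-1 :> R.
  rewrite /al mulrAC -powRD; last by rewrite (gt_eqF NR0) implybT.
  by rewrite -{2}[p^-1]mul1r -mulrDl -pq divff ?gt_eqF// powRr1// ltW.
apply: (weak_opnorm_ge (E := E) p0 al0 (ltW NR0) _ mF muF).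
- exact: exprn_gt0.
- by rewrite muE lee_fin ler_pM2r ?exprn_gt0//; lra.
move=> x [Jx xL].
have [k kN Jkx] : exists2 k, (k < N)%N & J k (x ord0 ord0).
  by move: Jx; rewrite -bigcup_mkord => -[k kN Jkx]; exists k.
move: Jkx; rewrite /J /= in_itv/= => /andP[x1 x2].
pose s : R := 4 ^+ k.+1 + 1.
have w1 y : 0 <= y <= 1 -> weight N q y <= 1.
  move=> /andP[y0 y1]; rewrite /weight big_nat big1 ?addr0; last first.
    move=> j _; rewrite /bump profile_supp ?mulr0// distrC.
    apply: lt_le_trans (ler_norm _); rewrite exprS; have := pow4_ge1 j; lra.
  have b1 : 1 <= base N y.
    apply: le_trans (_ : profile N N.+1 0 y <= _); last first.
      by rewrite lerDl invr_ge0 mulr_ge0// ltW.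
    by apply: profile_ge1 => //; rewrite subr0 ger0_norm.
  apply: le_trans (powRN_le (ltW q0) ltr01 b1) _.
  by rewrite powR1.
apply: lt_le_trans (@maximal_weighted_ge R n (weight N q) p L s x p0 _ w1 _ _ _ _).
- rewrite lte_fin /al.
  have wx : N%:R `^ q * (4 ^+ k.+1) `^ p <= weight N q (x ord0 ord0).
    rewrite pq -/(height N q k); apply: le_trans (_ : bump N q k (x ord0 ord0) <= _).
      rewrite -[leLHS]mulr1 ler_pM2l ?height_gt0//; apply: profile_ge1 => //.
      by rewrite ler_norml; lra.
    apply: (@le_trans _ _ (\sum_(0 <= j < N) bump N q j (x ord0 ord0))).
      rewrite big_mkord (bigD1 (Ordinal kN))//= lerDl.
      by apply: sumr_ge0 => j _; rewrite bump_ge0.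
    by rewrite lerDr powR_ge0.
  have wxp : N%:R `^ (q / p) * 4 ^+ k.+1 <= weight N q (x ord0 ord0) `^ p^-1.
    have -> : N%:R `^ (q / p) * 4 ^+ k.+1 = (N%:R `^ q * (4 ^+ k.+1) `^ p) `^ p^-1 :> R.
      rewrite powRM ?powR_ge0// -!powRrM divff ?gt_eqF// powRr1//; exact: ltW.
    apply: ge0_ler_powR => //.
    + by rewrite invr_ge0 ltW.
    + by rewrite nnegrE mulr_ge0 ?powR_ge0.
    + by rewrite nnegrE ltW// weight_gt0.
  have s0 : 0 < s by rewrite addr_gt0.
  rewrite ltr_pdivlMr//; apply: lt_le_trans wxp.
  rewrite mulrAC -mulrA ltr_pM2l ?powR_gt0// /s.
  have : 4 <= 4 ^+ k.+1 :> R by rewrite exprS; have := pow4_ge1 k; lra.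
  lra.
- by move=> y; rewrite ltW// weight_gt0.
- by rewrite /s lerDr ltW.
- by rewrite /s /L lerD2r ler_eXn2l// ltr1n.
- by apply/andP; rewrite /s; have := pow4_ge1 k.+1; split; lra.
- by move=> i; have := xL i; rewrite add0r.
Qed.

(** * The lower bound *)

Lemma phi_M_ge (R : realType) d (p t : R) (w : 'rV[R]_d -> R) (z : \bar R) :
  scalar_weight w -> (Ap_const p w <= t%:E)%E ->
  (z <= weak_opnorm p (maximal_weighted w p))%E -> (z <= phi_M d p t)%E.
Proof.
move=> sw Aw zw; apply: le_trans zw _.
by apply: ereal_sup_ubound; exists w.
Qed.

(** For [t] below the constant [Ap_factor], no [N >= 1] is available; the
    constant weight then provides a positive lower bound. *)
Lemma Ap_const_cst1 (R : realType) n (p : R) :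
  (Ap_const p (fun _ : 'rV[R]_n.+1 => 1%R) <= 1)%E.
Proof.
apply: ge_ereal_sup => _ [Q [a [l [l0 QE]]] <-].
rewrite (_ : Q = cube a l)//.
rewrite [X in (_ * X `^ _)%E](_ : _ = 1%E); last first.
  rewrite -[RHS](cube_avg_cst a 1 l0); congr cube_avg.
  by apply/funext => y; rewrite poweR_EFin powR1 inve1.
by rewrite poweR1r mule1 cube_avg_cst.
Qed.

Lemma weak_opnorm_cst1 (R : realType) n (p : R) : 0 < p ->
  ((1 / 2)%:E <= weak_opnorm p
     (maximal_weighted (fun _ : 'rV[R]_n.+1 => 1%R) p))%E.
Proof.
move=> p0.
pose F := prism (n := n) `[0, 1]%classic (fun=> 0 : R) 1.
have mF : measurable F by apply: measurable_prism.
have muF : lebesgue_rV n.+1 F = 1%:E.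
  rewrite lebesgue_rV_prism// expr1n mule1.
  by have := @lebesgue_measure_segment R 0 1 ler01; rewrite add0r.
have := @weak_opnorm_ge R n.+1 p (maximal_weighted (fun=> 1) p) F F (1 / 2) 1 1
  p0 _ ler01 ltr01 mF muF.
rewrite powR1 !mulr1; apply; first by rewrite divr_gt0.
  by rewrite muF.
move=> x [x0 xF].
apply: (@lt_le_trans _ _ 1%E); first by rewrite lte_fin; lra.
have := @maximal_weighted_ge R n (fun=> 1) p 1 1 x p0 (fun=> ler01) (fun _ _ => lexx _)
  (lexx _) (lexx _).
rewrite powR1 divr1; apply; first by move: x0; rewrite /= in_itv.
by move=> i; have := xF i; rewrite add0r.
Qed.

Lemma scalar_weight_cst1 (R : realType) n :
  scalar_weight (fun _ : 'rV[R]_n.+1 => 1%R).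
Proof.
apply: (@bounded_scalar_weight _ _ _ 1); first exact: measurable_cst.
by move=> x; rewrite ler01 lexx.
Qed.

(** [N] is the integer part of [(t / Ap_factor) ^ (1 / q)]. *)
Lemma phi_M_ge_powR (R : realType) n (p t : R) : 2 <= p -> 1 <= t ->
  (((t / Ap_factor (p - 1)) `^ (p - 1)^-1 / 4)%:E <= phi_M n.+1 p t)%E.
Proof.
move=> p2 t1; set q := p - 1; set C := Ap_factor q.
have q1 : 1 <= q by rewrite /q; lra.
have q0 : 0 < q by lra.
have p0 : 0 < p by lra.
have C0 : 0 < C.
  by rewrite /C /Ap_factor; have := powR_ge0 28 q; have := powR_ge0 14 q; lra.
have t0 : 0 <= t by rewrite (le_trans _ t1).
set z := (t / C) `^ q^-1.
have z0 : 0 <= z by rewrite powR_ge0.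
have [z1|z1] := leP 1 z; last first.
  apply: (@le_trans _ _ (1 / 2)%:E); first by rewrite lee_fin; lra.
  apply: phi_M_ge (weak_opnorm_cst1 _ p0); first exact: scalar_weight_cst1.
  by apply: le_trans (Ap_const_cst1 _ _) _; rewrite lee_fin.
have /andP[Nz zN] := truncn_itv z0.
set N := Num.truncn z in Nz zN *.
have N0 : (0 < N)%N.
  by rewrite lt0n; apply/eqP => N_eq0; move: zN; rewrite N_eq0; lra.
have N1 : 1 <= N%:R :> R by rewrite ler1n.
apply: (@le_trans _ _ (N%:R / 2)%:E).
  by rewrite lee_fin; move: zN; rewrite -natr1; lra.
apply: phi_M_ge (weight_weak_opnorm n N0 q1 _).
- exact: weight_scalar_weight.
- apply: le_trans (weight_Ap_const N0 q1 n erefl) _.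
  rewrite lee_fin -/C -ler_pdivlMl// mulrC.
  have -> : t / C = z `^ q.
    by rewrite /z -powRrM mulVf ?gt_eqF// powRr1// divr_ge0// ltW.
  by apply: ge0_ler_powR; rewrite ?nnegrE ?(ltW q0).
- by rewrite /q subrK.
Qed.

Theorem theorem1p3 (R : realType) (d : nat) (hd : (0 < d)%N) (p : R)
    (hp : 2 <= p) :
  exists c : R, 0 < c /\ forall t : R, 1 <= t ->
    ((c * t `^ (p - 1)^-1 * ln (t + expR 1) `^ (- p^-1))%:E <= phi_M d p t)%E.
Proof.
case: d hd => // n _.
have C0 : 0 < Ap_factor (p - 1).
  rewrite /Ap_factor; have := powR_ge0 28 (p - 1).
  by have := powR_ge0 14 (p - 1); lra.
exists ((Ap_factor (p - 1))^-1 `^ (p - 1)^-1 / 4); split.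
  by rewrite divr_gt0// powR_gt0// invr_gt0.
move=> t t1; apply: le_trans (phi_M_ge_powR n hp t1).
have t0 : 0 <= t by rewrite (le_trans _ t1).
rewrite lee_fin powRM ?invr_ge0 ?(ltW C0)//.
have ln1 : 1 <= ln (t + expR 1).
  rewrite -[leLHS](expRK 1) ler_ln ?posrE ?expR_gt0//; first by rewrite lerDr.
  by rewrite ltr_wpDl// expR_gt0.
have le1 : ln (t + expR 1) `^ (- p^-1) <= 1.
  rewrite -[leRHS](powRr0 (ln (t + expR 1))) ler_powR// oppr_le0 invr_ge0.
  by rewrite (le_trans _ hp).
have [P0 T0] := (powR_ge0 (Ap_factor (p - 1))^-1 (p - 1)^-1, powR_ge0 t (p - 1)^-1).
by have := ler_wpM2l (mulr_ge0 P0 T0) le1; lra.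
Qed.
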